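(* Let $G$ be a totally disconnected generalized $\overline{FC}$-group. Then the following conditions are equivalent: (i) $G$ is distal; (ii) every $g\in G$ is distal; (iii) $G$ is a SIN group.
   Context: All groups are Hausdorff. A locally compact group $G$ is a generalized $\overline{FC}$-group if it has a series $G=G_0\supseteq G_1\supseteq\dots\supseteq G_n=\{e\}$ of closed normal subgroups (of $G$) such that for every $i=0,\dots,n-1$, $G_i/G_{i+1}$ is a compactly generated group with precompact conjugacy classes. $G$ is distal if for every $x\in G\setminus\{e\}$, $e$ is not in the closure of $\{gxg^{-1} : g\in G\}$. An element $g\in G$ is distal if for every $x\in G\setminus\{e\}$, $e$ is not in the closure of $\{g^nxg^{-n} : n\in\mathbb Z\}$. $G$ is a SIN group if $e$ has a neighbourhood base consisting of neighbourhoods invariant under all inner automorphisms of $G$. *)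

(* Defs.v *)
From HB Require Import structures.
From mathcomp Require Import all_boot ssrint all_classical.
From mathcomp Require Import topology.

Set Implicit Arguments.
Unset Strict Implicit.
Unset Printing Implicit Defensive.

Local Open Scope classical_set_scope.
Local Open Scope quotient_scope.
Local Open Scope group_scope.

HB.mixin Record isTopologicalGroup G of Group G & Topological G := {
  mulg_continuous : continuous (fun xy : G * G => xy.1 * xy.2);
  invg_continuous : continuous (fun x : G => x^-1)
}.

#[short(type="topologicalGroupType")]
HB.structure Definition TopologicalGroup :=
  {G of isTopologicalGroup G & Group G & Topological G}.

Record subgroup (G : groupType) := Subgroup {
  subgroup_set :> set G;
  subgroup_closed : group_closed (mem subgroup_set)
}.

Record normal_subgroup (G : groupType) := NormalSubgroup {
  normal_subgroup_val :> subgroup G;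
  normal_subgroupJ : forall g x : G,
    subgroup_set normal_subgroup_val x ->
    subgroup_set normal_subgroup_val (g * x * g^-1)
}.

Section SubgroupTheory.
Context {G : groupType} (H : subgroup G).

Lemma subgroup1 : subgroup_set H 1.
Proof. by have [+ _] := subgroup_closed H; rewrite inE. Qed.

Lemma subgroupM x y :
  subgroup_set H x -> subgroup_set H y -> subgroup_set H (x * y).
Proof.
move=> Hx Hy; have /group_closedM := subgroup_closed H.
by move=> /(_ x y); rewrite !inE; apply.
Qed.

Lemma subgroupV x : subgroup_set H x -> subgroup_set H x^-1.
Proof.
move=> Hx; have /group_closedV := subgroup_closed H.
by move=> /(_ x); rewrite !inE; apply.
Qed.

HB.instance Definition _ := [isSub of set_type H for set_val].
HB.instance Definition _ :=
  SubChoice_isSubGroup.Build G _ (set_type H) (subgroup_closed H).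

End SubgroupTheory.

Section SubgroupTopology.
Context {G : topologicalGroupType} (H : subgroup G).

Let val_continuous : continuous (val : set_type H -> G).
Proof. exact: initial_continuous. Qed.

Let sub_continuous (T : topologicalType) (f : T -> set_type H) :
  continuous (val \o f) -> continuous f.
Proof. by move=> ?; exact/continuous_comp_initial. Qed.

Let mul_continuous :
  continuous (fun xy : set_type H * set_type H => xy.1 * xy.2).
Proof.
apply: sub_continuous => xy.
have vc : (fun zt : set_type H * set_type H => (val zt.1, val zt.2)) @ xy -->
    (val xy.1, val xy.2).
  apply: cvg_pair.
    by apply: (@cvg_comp _ _ _ _ val); [exact: cvg_fst | exact: val_continuous].
  by apply: (@cvg_comp _ _ _ _ val); [exact: cvg_snd | exact: val_continuous].
exact: (cvg_comp _ _ vc (mulg_continuous _)).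
Qed.

Let inv_continuous : continuous (fun x : set_type H => x^-1).
Proof.
apply: sub_continuous => x.
exact: (cvg_comp _ _ (val_continuous (x := x)) (invg_continuous _)).
Qed.

HB.instance Definition _ :=
  isTopologicalGroup.Build (set_type H) mul_continuous inv_continuous.

End SubgroupTopology.

(* [H `&` N] as a normal subgroup of the group [set_type H]. *)
Section SubgroupTrace.
Context {G : groupType} (H : subgroup G) (N : normal_subgroup G).

Definition subgroup_trace_set : set (set_type H) := val @^-1` subgroup_set N.

Let trace_closed : group_closed (mem subgroup_trace_set).
Proof.
split; first by rewrite inE; exact: subgroup1.
move=> x y; rewrite !inE => Nx Ny; apply: subgroupM => //.
exact: subgroupV.
Qed.

Let traceJ (g x : set_type H) :
  subgroup_trace_set x -> subgroup_trace_set (g * x * g^-1).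
Proof. by move=> Nx; exact: normal_subgroupJ. Qed.

Definition subgroup_trace : normal_subgroup (set_type H) :=
  @NormalSubgroup _ (Subgroup trace_closed) traceJ.

End SubgroupTrace.

Section Quotient.
Context {G : topologicalGroupType} (N : normal_subgroup G).

Definition coset_rel (x y : G) : bool := `[< subgroup_set N (x^-1 * y) >].

Let coset_rel_equiv : equiv_class_of coset_rel.
Proof.
split=> [x|x y|y x z]; first by apply/asboolP; rewrite mulVg; exact: subgroup1.
- by apply/asbool_equiv_eq; split=> /subgroupV; rewrite invgM invgK.
- move=> /asboolP xy /asboolP yz; apply/asboolP.
  by have := subgroupM xy yz; rewrite mulgA mulgK.
Qed.

Canonical coset_equiv := EquivRelPack coset_rel_equiv.

(* The group of left cosets [x N], with the quotient topology. *)
Definition quotient_group : Type := quotient_topology {eq_quot coset_rel}.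
HB.instance Definition _ := Topological.on quotient_group.
HB.instance Definition _ := Quotient.on quotient_group.
Local Notation Q := quotient_group.

Lemma piQP (x y : G) : \pi_Q x = \pi_Q y <-> subgroup_set N (x^-1 * y).
Proof.
split=> [/(@eqmodP _ coset_equiv) /asboolP //|h].
by apply/(@eqmodP _ coset_equiv)/asboolP.
Qed.

Lemma quotient_ind (P : Q -> Prop) : (forall x, P (\pi_Q x)) -> forall a, P a.
Proof. by move=> Ppi a; rewrite -[a]reprK. Qed.

Let piM (x y x' y' : G) : \pi_Q x = \pi_Q x' -> \pi_Q y = \pi_Q y' ->
  \pi_Q (x * y) = \pi_Q (x' * y').
Proof.
move=> /piQP xx /piQP yy; apply/piQP.
have := subgroupM (normal_subgroupJ y^-1 xx) yy.
by rewrite invgK invgM !mulgA mulgK.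
Qed.

Let piV (x x' : G) : \pi_Q x = \pi_Q x' -> \pi_Q x^-1 = \pi_Q x'^-1.
Proof.
move=> /piQP xx; apply/piQP; rewrite invgK.
have := normal_subgroupJ x xx; rewrite mulgA mulgV mul1g => /subgroupV.
by rewrite invgM invgK.
Qed.

Definition quotient_one : Q := \pi_Q 1.
Definition quotient_mul (a b : Q) : Q := \pi_Q (repr a * repr b).
Definition quotient_inv (a : Q) : Q := \pi_Q (repr a)^-1.

Lemma quotient_mulE (x y : G) :
  quotient_mul (\pi_Q x) (\pi_Q y) = \pi_Q (x * y).
Proof. by apply: piM; rewrite reprK. Qed.

Lemma quotient_invE (x : G) : quotient_inv (\pi_Q x) = \pi_Q x^-1.
Proof. by apply: piV; rewrite reprK. Qed.

Let quotient_mulA : associative quotient_mul.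
Proof.
elim/quotient_ind=> x; elim/quotient_ind=> y; elim/quotient_ind=> z.
by rewrite !quotient_mulE mulgA.
Qed.

Let quotient_mul1 : left_id quotient_one quotient_mul.
Proof. by elim/quotient_ind=> x; rewrite quotient_mulE mul1g. Qed.

Let quotient_mulr1 : right_id quotient_one quotient_mul.
Proof. by elim/quotient_ind=> x; rewrite quotient_mulE mulg1. Qed.

Let quotient_mulV : left_inverse quotient_one quotient_inv quotient_mul.
Proof. by elim/quotient_ind=> x; rewrite quotient_invE quotient_mulE mulVg. Qed.

Let quotient_mulrV : right_inverse quotient_one quotient_inv quotient_mul.
Proof. by elim/quotient_ind=> x; rewrite quotient_invE quotient_mulE mulgV. Qed.

HB.instance Definition _ := isGroup.Build Q
  quotient_mulA quotient_mul1 quotient_mulr1 quotient_mulV quotient_mulrV.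

Lemma quotient_pi1 : \pi_Q 1 = 1 :> Q. Proof. by []. Qed.

Lemma quotient_piM (x y : G) : \pi_Q (x * y) = \pi_Q x * \pi_Q y.
Proof. by rewrite -quotient_mulE. Qed.

Lemma quotient_piV (x : G) : \pi_Q x^-1 = (\pi_Q x)^-1.
Proof. by rewrite -quotient_invE. Qed.

Lemma quotient_pi_continuous : continuous (\pi_Q : G -> Q).
Proof. exact: pi_continuous. Qed.

Lemma quotient_openE (U : set Q) : open U = open (\pi_Q @^-1` U : set G).
Proof. by []. Qed.

Lemma quotient_pi_open (U : set G) : open U -> open (\pi_Q @` U).
Proof.
move=> oU; rewrite quotient_openE.
have -> : \pi_Q @^-1` (\pi_Q @` U) =
    \bigcup_(n in subgroup_set N) ((fun x => x * n) @^-1` U).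
  apply/seteqP; split=> x /=.
    move=> [u Uu /esym/piQP Nxu]; exists (x^-1 * u) => //=.
    by rewrite mulgA mulgV mul1g.
  move=> [n Nn /= Uxn]; exists (x * n) => //; apply/esym/piQP.
  by rewrite mulgA mulVg mul1g.
apply: bigcup_open => n _; apply: open_comp oU => x _.
have xn : (fun z => (z, n)) @ x --> (x, n).
  by apply: cvg_pair; [exact: cvg_id | exact: cvg_cst].
exact: (cvg_comp _ _ xn (mulg_continuous _)).
Qed.

Let quotient_mul_continuous : continuous (fun ab : Q * Q => ab.1 * ab.2).
Proof.
case; elim/quotient_ind=> x; elim/quotient_ind=> y W /=; rewrite -quotient_piM => nW.
have : nbhs (x, y) ((fun xy => \pi_Q (xy.1 * xy.2)) @^-1` W).
  have := cvg_comp _ _ (mulg_continuous (x, y)) (@quotient_pi_continuous _).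
  exact.
have nbhs_pi (z : G) (A : set G) : nbhs z A -> nbhs (\pi_Q z) (\pi_Q @` A).
  rewrite !nbhsE => -[B [oB Bz] BA]; exists (\pi_Q @` B).
    by split; [exact: quotient_pi_open | exists z].
  exact: image_subset.
move=> [[A B] /= [nA nB] AB]; exists (\pi_Q @` A, \pi_Q @` B).
  by split; exact: nbhs_pi.
move=> _ [/= [a Aa <-] [b Bb <-]]; rewrite -quotient_piM.
exact: (AB (a, b)).
Qed.

Let quotient_inv_continuous : continuous (fun a : Q => a^-1).
Proof.
apply/continuousP => U oU; rewrite quotient_openE.
have -> : \pi_Q @^-1` ((fun a : Q => a^-1) @^-1` U) =
    (fun x : G => x^-1) @^-1` (\pi_Q @^-1` U).
  by apply/seteqP; split=> x /=; rewrite quotient_piV.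
by apply: open_comp => // x _; exact: invg_continuous.
Qed.

HB.instance Definition _ := isTopologicalGroup.Build Q
  quotient_mul_continuous quotient_inv_continuous.

End Quotient.

Section Notions.
Context (G : topologicalGroupType).

(* [smallest (fun A => group_closed (mem A)) K] is the subgroup generated by
   [K]. *)
Definition compactly_generated :=
  exists2 K : set G, compact K &
    smallest (fun A : set G => group_closed (mem A)) K = [set: G].

Definition conjugacy_class (x : G) : set G := [set g * x * g^-1 | g in [set: G]].

Definition precompact_conjugacy_classes :=
  forall x : G, precompact (conjugacy_class x).

Definition expgz (g : G) (n : int) : G :=
  match n with Posz k => g ^+ k | Negz k => g ^- k.+1 end.

Definition distal_group := forall x : G, x <> 1 -> ~ closure (conjugacy_class x) 1.

Definition distal_element (g : G) := forall x : G, x <> 1 ->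
  ~ closure ([set expgz g n * x * expgz g (- n)%R | n in [set: int]] : set G) 1.

Definition SIN_group := forall U : set G, nbhs 1 U ->
  exists V : set G, [/\ nbhs 1 V, V `<=` U &
    forall g : G, [set g * x * g^-1 | x in V] = V].

End Notions.

(* Only the terms [N 0, ..., N n] of the sequence [N] matter. Local compactness
   is part of the definition, the Hausdorff property is not. *)
Definition generalized_FC_group (G : topologicalGroupType) :=
  locally_compact [set: G] /\
  exists (n : nat) (N : nat -> normal_subgroup G),
    [/\ N 0%N = [set: G] :> set G, N n = [set 1] :> set G,
        forall i, (i <= n)%N -> closed (N i : set G),
        forall i, (i < n)%N -> N i.+1 `<=` N i &
        forall i, (i < n)%N ->
          let Q := quotient_group (subgroup_trace (N i) (N i.+1)) in
          compactly_generated Q /\ precompact_conjugacy_classes Q].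

(* Main.v *)
Require Import Defs.
From HB Require Import structures.
From mathcomp Require Import all_boot ssrint all_classical.
From mathcomp Require Import topology.

Local Open Scope classical_set_scope.
Local Open Scope quotient_scope.
Local Open Scope group_scope.

Set Implicit Arguments.
Unset Strict Implicit.
Unset Printing Implicit Defensive.

(** A SIN group is distal, since an invariant neighbourhood of [1] that misses
[x] misses the whole conjugacy class of [x]; and in a distal group every element
is distal, since an orbit of conjugation by powers of [g] lies in a conjugacy
class.  The content is that distality of the elements makes [G] a SIN group.

Say that a subset [A] of [G] is conjugation-equicontinuous if every
neighbourhood of [1] contains another one that all conjugations by elements of
[A] map into the first.  The group is SIN when [G] itself has this property.
Compact sets have it, and it passes to subsets, finite unions and, decisively,
to products [A B]; families with these closure properties are called product
ideals ([product_ideal]).  So it is enough to write [G] as a finite product of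
compact sets and cyclic groups, and to show that cyclic groups generated by
distal elements are conjugation-equicontinuous.

Cyclic groups.  By van Dantzig's theorem ([van_dantzig]) the compact open
subgroups form a basis at [1].  Let [g] be distal and [U] a compact open
subgroup.  Conjugation by [g] cannot map a compact subgroup [W] properly into
itself: in the Ellis semigroup of limits of the iterates of this endomorphism
[b] of [W] there is an idempotent [p]; as [p (p(x)^-1 x) = 1], the element
[p(x)^-1 x] has an orbit accumulating at [1], so it is [1] by distality and
[x = p(x)] lies in the image of [b] ([compact_endomorphism_surjective]).  Applied
to the intersection of all [g^i U g^-i] with [i >= 0] and then, after a
compactness argument, to the intersection for [0 <= i <= n], this produces a
compact open subgroup of [U] normalized by [g]
([distal_element_normalizes]).

Products.  Let [Q] be a compactly generated group with precompact conjugacy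
classes and a basis of compact open subgroups.  A Baire category argument gives
an open subgroup whose conjugates all lie in one compact set.  Words in a
conjugation-invariant set can be sorted, because [b c = c (c^-1 b c)]; hence if
such a set is covered by finitely many cosets [f W] with [W] normalized by [f],
it generates a group contained in a finite product of sets
[{f^n | n} W] ([ideal_words], [words_coset]).  Used once, this yields a
relatively compact open normal subgroup [H]; used again with cosets of [H], it
shows that every product ideal containing the cyclic groups contains [Q]
([product_ideal_FC_group]).

Applying this to [Q = N_i / N_(i+1)] and to the ideal of those subsets of [Q]
whose preimage in [G] is conjugation-equicontinuous, the property climbs along
the series from the trivial group to [G]
([conj_equicontinuous_extension]). *)

(** * Compactness *)

(** Compactness as a principle of passage from local to global: it is applied to
ideals of sets, which spares the handling of finite subcovers. *)
Lemma compact_ideal (T : topologicalType) (I : set T -> Prop) (K : set T) :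
  (forall A B, A `<=` B -> I B -> I A) ->
  (forall A B, I A -> I B -> I (A `|` B)) ->
  compact K -> I set0 -> (forall x, K x -> exists2 U, nbhs x U & I U) -> I K.
Proof.
move=> subI unionI cK I0 locI; apply: contrapT => nIK.
pose F : set_system T := [set A | I (K `\` A)].
have PF : ProperFilter F.
  split; first by rewrite /F /= setD0.
  split.
  - by rewrite /F /= setDT.
  - move=> A B FA FB; rewrite /F /= setDIr; exact: unionI.
  - by move=> A B AB; apply: subI; exact: setDS.
have FK : F K by rewrite /F /= setDv.
have [x [Kx clx]] := cK F PF FK.
have [U xU IU] := locI x Kx.
have FnU : F (~` U) by apply: subI IU => y [_ /contrapT].
by have [y []] := clx _ _ FnU xU.
Qed.

Lemma compact_directed (T : topologicalType) (I : Type) (D : set I)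
    (F : I -> set T) (K : set T) :
  compact K -> D !=set0 -> (forall i, D i -> closed (F i)) ->
  (forall i j, D i -> D j -> exists2 k, D k & F k `<=` F i `&` F j) ->
  (forall i, D i -> K `&` F i !=set0) ->
  K `&` \bigcap_(i in D) F i !=set0.
Proof.
move=> cK [i0 Di0] clF dirF KF.
pose G := filter_from D (fun i => K `&` F i).
have FG : Filter G.
  apply: filter_from_filter; first by exists i0.
  move=> i j Di Dj; have [k Dk Fk] := dirF i j Di Dj.
  by exists k => // x [Kx /Fk[]].
have PG : ProperFilter G by apply: filter_from_proper => i Di; exact: KF.
have GK : G K by exists i0 => // x [].
have [x [Kx clx]] := cK G PG GK; exists x; split=> // i Di.
apply: (clF i Di) => W xW.
have Gi : G (F i) by exists i => // y [].
by have [y [? ?]] := clx _ _ Gi xW; exists y.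
Qed.

Lemma compact_tube (S T : topologicalType) (K : set S) (y : T)
    (P : set (S * T)) : compact K ->
  (forall t, K t -> nbhs (t, y) P) -> \near y, forall t, K t -> P (t, y).
Proof.
move=> /compact_near_coveringP cK KP.
apply: (cK T (nbhs y) (fun y t => P (t, y))) => t Kt.
by apply: filterS (KP t Kt) => -[].
Qed.

Lemma compact_image (S T : topologicalType) (f : S -> T) (A : set S) :
  continuous f -> compact A -> compact (f @` A).
Proof.
by move=> cf; apply: continuous_compact; exact: continuous_subspaceT.
Qed.

Section SetType.
Context {T : topologicalType} (A : set T).

Lemma set_type_val_continuous : continuous (val : set_type A -> T).
Proof. exact: initial_continuous. Qed.

Lemma continuous_set_type (Z : topologicalType) (f : Z -> set_type A) :
  continuous (val \o f) -> continuous f.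
Proof. by move=> ?; exact/continuous_comp_initial. Qed.

Lemma set_type_nbhs (x : set_type A) (U : set (set_type A)) :
  nbhs x U -> exists2 O, nbhs (val x) O & val @^-1` O `<=` U.
Proof.
move=> [V [[O oO <-] Ox OU]]; exists O => //.
by apply: open_nbhs_nbhs; split.
Qed.

Lemma set_type_closure (B : set (set_type A)) x :
  closure B x -> closure (val @` B) (val x).
Proof.
move=> clx U Ux; have [y [By Uy]] := clx _ (@set_type_val_continuous x _ Ux).
by exists (val y); split=> //; exists y.
Qed.

Lemma set_type_compact (B : set (set_type A)) :
  compact (val @` B) -> compact B.
Proof.
move=> cB F PF FB.
have FvB : F (val @^-1` (val @` B)) by apply: filterS FB => x Bx; exists x.
have [_ [[x Bx <-] clx]] := cB (val @ F) _ FvB.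
exists x; split=> // C D FC /set_type_nbhs[O xO OD].
have FvC : F (val @^-1` (val @` C)) by apply: filterS FC => y Cy; exists y.
have [_ [[y Cy <-] Oy]] := clx _ _ FvC xO.
by exists y; split=> //; exact: OD.
Qed.

Lemma set_type_compactT : compact A -> compact [set: set_type A].
Proof.
move=> cA; apply: set_type_compact; rewrite (_ : _ @` _ = A) //.
apply/seteqP; split=> [_ [x _ <-]|x Ax]; first exact: set_mem (valP x).
by exists (SigSub (mem_set Ax)).
Qed.

Lemma set_type_hausdorff : hausdorff_space T -> hausdorff_space (set_type A).
Proof.
move=> hT x y clxy; apply: val_inj; apply: hT => U V Ux Vy.
have vC := set_type_val_continuous.
have [z [Uz Vz]] := clxy _ _ (vC x _ Ux) (vC y _ Vy).
by exists (val z).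
Qed.
End SetType.

(** * Translations and conjugations *)

Section TopologicalGroupTheory.
Context {G : topologicalGroupType}.
Implicit Types (g x : G) (A U : set G).

Lemma cvgM (T : Type) (F : set_system T) {FF : Filter F} (f h : T -> G) a b :
  f @ F --> a -> h @ F --> b -> (fun t => f t * h t) @ F --> a * b.
Proof.
move=> fa hb.
exact: (cvg_comp _ _ (cvg_pair fa hb) (mulg_continuous (a, b))).
Qed.

Lemma cvgV (T : Type) (F : set_system T) {FF : Filter F} (f : T -> G) a :
  f @ F --> a -> (fun t => (f t)^-1) @ F --> a^-1.
Proof. by move=> fa; exact: (cvg_comp _ _ fa (invg_continuous a)). Qed.

Lemma continuousM (Z : topologicalType) (f h : Z -> G) :
  continuous f -> continuous h -> continuous (fun z => f z * h z).
Proof. by move=> cf ch z; apply: cvgM; [exact: cf | exact: ch]. Qed.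

Lemma continuousV (Z : topologicalType) (f : Z -> G) :
  continuous f -> continuous (fun z => (f z)^-1).
Proof. by move=> cf z; apply: cvgV; exact: cf. Qed.

Lemma mulgl_continuous g : continuous (fun x => g * x).
Proof. by move=> x; apply: cvgM; [exact: cvg_cst | exact: cvg_id]. Qed.

(** Conjugation as a left action, [conjl (g * h) = conjl g \o conjl h], unlike the
right action [x ^ g]. *)
Definition conjl g x := g * x * g^-1.

Lemma conjl_continuous g : continuous (conjl g).
Proof.
move=> x; apply: cvgM; last exact: cvg_cst.
exact: mulgl_continuous.
Qed.

Lemma conjlM g x y : conjl g (x * y) = conjl g x * conjl g y.
Proof. by rewrite /conjl !mulgA mulgVK. Qed.

Lemma conjlV g x : conjl g x^-1 = (conjl g x)^-1.
Proof. by rewrite /conjl !invgM invgK mulgA. Qed.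

Lemma conjl1 g : conjl g 1 = 1.
Proof. by rewrite /conjl mulg1 mulgV. Qed.

Lemma conjlMl g h x : conjl (g * h) x = conjl g (conjl h x).
Proof. by rewrite /conjl invgM !mulgA. Qed.

Lemma conj1l x : conjl 1 x = x.
Proof. by rewrite /conjl mul1g invg1 mulg1. Qed.

Lemma conjlK g : cancel (conjl g) (conjl g^-1).
Proof. by move=> x; rewrite -conjlMl mulVg conj1l. Qed.

Lemma conjlVK g : cancel (conjl g^-1) (conjl g).
Proof. by move=> x; rewrite -conjlMl mulgV conj1l. Qed.

Lemma conjlX g x n : conjl g (x ^+ n) = conjl g x ^+ n.
Proof. by elim: n => [|n ih]; rewrite ?conjl1 // !expgS conjlM ih. Qed.

Lemma conjXl g n : conjl (g ^+ n) = iter n (conjl g).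
Proof.
apply/funext => x; elim: n => [|n ih]; first by rewrite expg0 conj1l.
by rewrite expgS conjlMl ih.
Qed.

Lemma nbhs_mulgl g x A : nbhs (g * x) A <-> nbhs x [set y | A (g * y)].
Proof.
split; first exact: mulgl_continuous.
move=> h.
have gx : (fun y => g^-1 * y) @ (g * x) --> x.
  by have := @mulgl_continuous g^-1 (g * x); rewrite /continuous_at mulKg.
have {gx}h' : nbhs (g * x) [set y | A (g * (g^-1 * y))] := gx _ h.
by move: h'; apply: filterS => y /=; rewrite mulVKg.
Qed.

Lemma nbhs_mulgl1 g A : nbhs g A <-> nbhs (1 : G) [set y | A (g * y)].
Proof. by rewrite -nbhs_mulgl mulg1. Qed.

End TopologicalGroupTheory.

Section OpenSubgroups.
Context {G : topologicalGroupType}.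

Lemma subgroup_open (V : subgroup G) : nbhs (1 : G) V -> open V.
Proof.
move=> V1; rewrite openE => x Vx; apply/nbhs_mulgl1.
by apply: filterS V1 => y Vy; exact: subgroupM.
Qed.

Lemma coset_nbhs (V : subgroup G) x :
  open V -> nbhs x [set y | subgroup_set V (x^-1 * y)].
Proof.
move=> oV; apply/nbhs_mulgl1; apply: (filterS (P := subgroup_set V)) => [y Vy|].
  by rewrite /mkset mulKg.
by apply: open_nbhs_nbhs; split=> //; exact: subgroup1.
Qed.

Lemma coset_saturated_closed (V : subgroup G) (A : set G) : open V ->
  (forall x v, A x -> subgroup_set V v -> A (x * v)) -> closed A.
Proof.
move=> oV Asat x clx.
have [y [Ay Vy]] := clx _ (coset_nbhs x oV).
by rewrite -(mulVKg y x) -[y^-1 * x]invgK invgM invgK; apply/Asat/subgroupV.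
Qed.

Lemma subgroup_open_closed (V : subgroup G) : open V -> closed V.
Proof.
by move=> oV; apply: coset_saturated_closed oV _ => x v; exact: subgroupM.
Qed.

End OpenSubgroups.


(** * Compact open subgroups *)

(** The relatively clopen subsets of a compact neighbourhood that contain [x]
intersect in a connected set, hence in [x] alone; by compactness one of them is
already small, and one lying in the interior is open in the whole space. *)
Lemma totally_disconnected_compact_open (T : topologicalType) (K U : set T)
    (x : T) :
  hausdorff_space T -> totally_disconnected [set: T] ->
  compact K -> nbhs x K -> nbhs x U ->
  exists C, [/\ open C, compact C, C x & C `<=` U].
Proof.
move=> hT tdT cK xK xU.
have [L xL [cL LK]] : exists2 L, nbhs x L & closed L /\ L `<=` K°.
  have [L xL LK] := compact_regular hT cK xK (nbhs_interior xK).
  exists (closure L); last by split=> //; exact: closed_closure.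
  by apply: filterS xL; exact: subset_closure.
have cptL : compact L.
  apply: subclosed_compact cK _ => //.
  exact: subset_trans LK (@interior_subset _ _).
pose F := [set C | [/\ C `<=` L, closed C, closed (L `\` C) & C x]].
have FL : F L.
  by split=> //; [rewrite setDv; exact: closed0 | exact: nbhs_singleton].
have FI C D : F C -> F D -> F (C `&` D).
  move=> [CL cC cLC Cx] [DL cD cLD Dx]; split=> //.
  - by move=> y [/CL].
  - exact: closedI.
  - by rewrite setDIr; exact: closedU.
have Fsmall O : open O -> \bigcap_(C in F) C `<=` O ->
    exists2 C, F C & C `<=` O.
  move=> oO QO; apply: contrapT => nF.
  have [||||y [_ Fy]] := @compact_directed _ _ F (fun C => C `\` O) _ cptL.
  - by exists L.
  - by move=> C [_ cC _ _]; apply: closedI cC _; exact: open_closedC.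
  - move=> C D FC FD; exists (C `&` D); first exact: FI.
    by move=> y [[Cy Dy] nOy].
  - move=> C FC; apply: contrapT => LC0; apply: nF; exists C => // y Cy.
    apply: contrapT => nOy; apply: LC0; exists y; split => //.
    by have [CL _ _ _] := FC; exact: CL.
  have [_] := Fy _ FL; apply; apply: QO => C FC.
  by have [] := Fy _ FC.
have Qx : (\bigcap_(C in F) C) x by move=> C [].
have clQ : closed (\bigcap_(C in F) C) by apply: closed_bigI => C [].
have QL : \bigcap_(C in F) C `<=` L by move=> y; exact.
have cQ : connected (\bigcap_(C in F) C).
  apply/connectedP => E [E0 QE [sE1 sE2]].
  have clE b : closed (E b).
    have -> : E b = (\bigcap_(C in F) C) `&` closure (E b).
      rewrite QE; apply/seteqP; split=> y.
        by move=> Ey; split; [case: b Ey; [right|left]|exact: subset_closure].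
      case: b => -[[] // Ey cEy].
        by have : set0 y by rewrite -sE2.
      by have : set0 y by rewrite -sE1.
    exact: closedI clQ (@closed_closure _ _).
  wlog Ex : E E0 QE sE1 sE2 clE / E false x.
    move=> wl; have := Qx; rewrite {1}QE => -[|Ex].
      exact: wl E0 QE sE1 sE2 clE.
    apply: (wl (E \o negb)) => //=.
    - by rewrite QE setUC.
    - by rewrite setIC.
    - by rewrite setIC.
  have EK : E false `<=` K°.
    by move=> y Ey; apply: LK; apply: QL; rewrite QE; left.
  have E1n : set_nbhs (E false) (~` E true).
    move=> y Ey; apply: open_nbhs_nbhs; split; first exact: closed_openC.
    move=> E1y; suff : set0 y by [].
    by rewrite -sE1; split=> //; exact: subset_closure.
  (* Shrinking C to C `&` closure O, still relatively clopen, expels the part of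
     the intersection that does not contain x. *)
  have [O /set_nbhsP[O' [oO' EO' O'O]] OE] :=
    compact_normal_local hT cK EK (clE false) E1n.
  have oOu : open (O' `|` ~` closure O).
    by apply: openU => //; apply: closed_openC; exact: closed_closure.
  have [y|C [CL cC cLC Cx] CO] := Fsmall _ oOu.
    rewrite QE => -[/EO'|E1y]; first by left.
    by right => /OE.
  have FCO : F (C `&` closure O).
    split=> //.
    - by move=> y [/CL].
    - exact: closedI (@closed_closure _ _).
    - rewrite (_ : _ `\` _ = (L `\` C) `|` (C `&` ~` O')).
        by apply: closedU => //; apply: closedI cC _; exact: open_closedC.
      apply/seteqP; split=> y.
        move=> [Ly nCOy]; have [Cy|] := pselect (C y); last by left.
        right; split=> // O'y; apply: nCOy; split=> //.
        by apply: subset_closure; exact: O'O.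
      move=> [[Ly nCy]|[Cy nO'y]]; first by split=> // -[].
      by split=> [|[_ clOy]]; [exact: CL|case: (CO y Cy)].
    - by split=> //; apply: subset_closure; apply: O'O; exact: EO'.
  have [y E1y] := E0 true.
  have Qy : (\bigcap_(C in F) C) y by rewrite QE; right.
  by have [_ /OE] := Qy _ FCO.
have Q1 : \bigcap_(C in F) C `<=` [set x].
  by rewrite -(tdT x) //; exact: connected_component_max.
have oUL : open (U° `&` L°) by apply: openI; exact: open_interior.
have [y /Q1 ->|C [CL cC cLC Cx] CUL] := Fsmall _ oUL.
  by split; [exact: xU | exact: xL].
exists C; split=> //.
- rewrite (_ : C = L° `&` ~` (L `\` C)).
    by apply: openI; [exact: open_interior | exact: closed_openC].
  apply/seteqP; split=> y.
    by move=> Cy; split=> [|[]//]; case: (CUL y Cy).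
  by move=> [/interior_subset Ly nLC]; apply: contrapT => nCy; apply: nLC.
- exact: subclosed_compact cC cptL CL.
- by move=> y /CUL[/interior_subset].
Qed.

Definition locally_profinite (G : topologicalGroupType) :=
  forall U : set G, nbhs (1 : G) U ->
    exists V : subgroup G, [/\ open V, compact V & V `<=` U].

Section MakeSubgroup.
Context {G : groupType} (A : set G).
Hypotheses (A1 : A 1) (AM : forall x y, A x -> A y -> A (x * y))
  (AV : forall x, A x -> A x^-1).

Lemma make_subgroup_closed : group_closed (mem A).
Proof.
split; rewrite ?inE // => x y; rewrite !inE => Ax Ay.
by apply: AM => //; exact: AV.
Qed.

Definition make_subgroup := Subgroup make_subgroup_closed.
End MakeSubgroup.

Section VanDantzig.
Context {G : topologicalGroupType}.

Definition left_stabilizer (C : set G) : set G :=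
  [set x | (forall c, C c -> C (x * c)) /\ (forall c, C c -> C (x^-1 * c))].

(** The stabilizer of a compact open neighbourhood [C] of [1] under left
translations lies in [C], and is open because [C] is compact. *)
Lemma van_dantzig :
  hausdorff_space G -> totally_disconnected [set: G] ->
  locally_compact [set: G] -> locally_profinite G.
Proof.
move=> hG tdG lcG U U1.
have [K + [cK _]] := lcG 1 I; rewrite withinET => K1.
have [C [oC cC C1 CU]] := totally_disconnected_compact_open hG tdG cK K1 U1.
pose V := @make_subgroup G (left_stabilizer C).
have H1 : left_stabilizer C 1 by split=> c; rewrite ?invg1 mul1g.
have HM x y :
    left_stabilizer C x -> left_stabilizer C y -> left_stabilizer C (x * y).
  move=> [Cx Cx'] [Cy Cy']; split=> c Cc; rewrite ?invgM -mulgA.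
    by apply: Cx; exact: Cy.
  by apply: Cy'; exact: Cx'.
have HV x : left_stabilizer C x -> left_stabilizer C x^-1.
  by move=> [? ?]; split; rewrite ?invgK.
have oV : open (V H1 HM HV).
  apply: subgroup_open.
  have C11 : nbhs (1 : G) [set x | forall c, C c -> C (x * c)].
    apply: (compact_tube (P := [set p | C (p.2 * p.1)]) cC) => c Cc.
    have h : (fun p : G * G => p.2 * p.1) @ (c, 1) --> c.
      rewrite -{2}[c]mul1g; apply: cvgM; [exact: cvg_snd|exact: cvg_fst].
    by apply: h; apply: open_nbhs_nbhs.
  have i1 : (fun x : G => x^-1) @ (1 : G) --> (1 : G).
    by rewrite -{2}invg1; exact: invg_continuous.
  apply: filterI => //; exact: i1 _ C11.
have VC : V H1 HM HV `<=` C by move=> x [Cx _]; rewrite -[x]mulg1; exact: Cx.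
exists (V H1 HM HV); split=> //; last exact: subset_trans CU.
apply: subclosed_compact cC VC; exact: subgroup_open_closed.
Qed.

End VanDantzig.


(** * Endomorphisms of compact groups *)

(** Ellis-Numakura lemma.  For [p] in a minimal closed subsemigroup [M] both
[M p] and the set of [y] in [M] with [y p = p] are closed subsemigroups, hence
equal to [M].  Only right translations have to be continuous, as is the case
for composition of functions under pointwise convergence. *)
Lemma ellis_idempotent (T : topologicalType) (op : T -> T -> T) (S : set T) :
  hausdorff_space T -> associative op -> (forall y, continuous (op^~ y)) ->
  compact S -> S !=set0 -> (forall x y, S x -> S y -> S (op x y)) ->
  exists2 p, S p & op p p = p.
Proof.
move=> hT opA opC cS S0 opS.
have clS : closed S by exact: compact_closed.
pose good M := [/\ closed M, M !=set0 & forall x y, M x -> M y -> M (op x y)].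
(* Maximal complements are used, as Zorn's lemma is stated for unions; the empty
   chain is why complements are taken inside S. *)
have [F FP totF|A [[clM [p Mp] opM] minA]] :=
    @Zorn_bigcup T (fun X => good (S `\` X)).
  have [->|/set0P[X0 FX0]] := eqVneq F set0.
    by rewrite bigcup_set0 setD0; split.
  have SD X : F X -> good (S `\` X) by exact: FP.
  have DE : S `\` \bigcup_(X in F) X = S `&` \bigcap_(X in F) (S `\` X).
    apply/seteqP; split=> x [Sx nFx]; split=> //.
      by move=> X FX; split=> // Xx; apply: nFx; exists X.
    by move=> [X FX Xx]; have [] := nFx X FX.
  split.
  - by rewrite DE; apply: closedI clS _; apply: closed_bigI => X /SD[].
  - rewrite DE; apply: compact_directed => //.
    + by exists X0.
    + by move=> X /SD[].
    + move=> X Y FX FY; have [XY|YX] := totF X Y FX FY.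
        exists Y => // x [Sx nYx]; split=> //; split=> // /XY.
        exact: nYx.
      by exists X => // x [Sx nXx]; split=> //; split=> // /YX; exact: nXx.
    + by move=> X /SD[_ [x [Sx nXx]] _]; exists x.
  - rewrite DE => x y [Sx Fx] [Sy Fy]; split; first exact: opS.
    by move=> X FX; have [_ _] := SD X FX; apply; [exact: Fx | exact: Fy].
have minM N : good N -> N `<=` S `\` A -> S `\` A `<=` N.
  move=> gN NM x [Sx nAx]; apply: contrapT => nNx.
  apply: (minA (~` N)).
    split; first by move=> y Ay Ny; have [] := NM y Ny.
    by move=> /(_ x nNx).
  by rewrite (_ : _ `\` _ = N) // setDE setCK; apply/setIidr => y /NM[].
have cM : compact (S `\` A) by apply: subclosed_compact cS _ => // x [].
have [x Mx xp] : [set op x p | x in S `\` A] p.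
  apply: minM => //; last by move=> _ [x Mx <-]; exact: opM.
  split.
  - by apply: compact_closed => //; exact: compact_image (opC p) cM.
  - by exists (op p p); exists p.
  - move=> _ _ [x Mx <-] [y My <-].
    exists (op (op x p) y); last by rewrite !opA.
    by apply: (opM) => //; exact: (opM).
have [_ //] : ((S `\` A) `&` [set y | op y p = p]) p.
  apply: minM => //.
  split.
  - apply: closedI clM _.
    apply: (closed_comp (f := op^~ p) (D := [set p])).
      by move=> y _; exact: opC.
    by apply: compact_closed => //; exact: compact_set1.
  - by exists x.
  - by move=> y z [My yp] [Mz zp]; split; [exact: opM|rewrite /= -opA zp].
by exists p => //; case: Mp.
Qed.

Section CompactEndomorphism.
Import ArrowAsProduct.
Context {W : topologicalGroupType} (b : W -> W).
Hypotheses (hW : hausdorff_space W) (cW : compact [set: W])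
  (bC : continuous b) (bM : forall x y, b (x * y) = b x * b y).

(** An idempotent limit [p] of the iterates of [b] is again an endomorphism, with
values in the compact image of [b].  Since [p (p(x)^-1 x) = 1], the orbit of
[p(x)^-1 x] accumulates at [1], so that [x = p(x)]. *)
Lemma compact_endomorphism_surjective :
  (forall x, closure [set iter n.+1 b x | n in [set: nat]] 1 -> x = 1) ->
  forall x, exists y, x = b y.
Proof.
move=> distb.
pose F : topologicalType := W -> W.
have hF : hausdorff_space F by exact: (@hausdorff_product W (fun=> W)).
have evC x : continuous (fun f : F => f x).
  exact: (@proj_continuous W (fun=> W) x).
have toF (Z : topologicalType) (h : Z -> F) :
    (forall x, continuous (fun z => h z x)) -> continuous h.
  move=> hC z; apply/cvg_sup => i U [V] [[O oO <-] Ohz OU].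
  apply: (filterS OU); apply: (hC i z).
  by apply: open_nbhs_nbhs; split.
pose P : set F := [set iter n.+1 b | n in [set: nat]].
have iterP : P `<=` closure P := @subset_closure _ P.
have limP (A : set F) : closed A -> P `<=` A -> closure P `<=` A.
  by move=> cA PA; rewrite [X in _ `<=` X](closure_id A).1 //; exact: closureS.
have iterC n : continuous (iter n b).
  elim: n => [|n ih] x; first exact: cvg_id.
  exact: (continuous_comp (ih x) (@bC _)).
have [|||||p Pp ppp] := @ellis_idempotent F (fun f g => f \o g) (closure P) hF.
- by [].
- by move=> g; apply: toF => x; exact: evC.
- apply: (subclosed_compact (B := setT)); [exact: closed_closure| |by []].
  rewrite (_ : setT = [set f : F | forall i, [set: W] (f i)]); last first.
    by apply/seteqP; split.
  exact: (@tychonoff W (fun=> W) (fun=> setT)).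
- by exists b; apply: iterP; exists 0%N.
- move=> f g Pf Pg.
  (* Composition is continuous in its outer argument, and in its inner one as
     long as the outer one is an iterate of b: two passages to the limit. *)
  have bcl n : closure P `<=` (fun h : F => iter n.+1 b \o h) @^-1` closure P.
    apply: limP.
      apply: closed_comp; last exact: closed_closure.
      move=> h _; apply: toF => x {}h.
      exact: (continuous_comp (@evC x h) (@iterC n.+1 _)).
    move=> _ [m _ <-]; apply: iterP; exists (n.+1 + m)%N => //.
    by apply/funext => x; rewrite -addnS iterD.
  suff : closure P `<=` (fun h : F => h \o g) @^-1` closure P by apply.
  apply: limP; last by move=> _ [n _ <-]; exact: bcl.
  apply: closed_comp; last exact: closed_closure.
  by move=> h _; apply: toF => x; exact: evC.
have c1 : closed [set (1 : W)].
  by apply: compact_closed => //; exact: compact_set1.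
have iterM n x y : iter n b (x * y) = iter n b x * iter n b y.
  by elim: n => //= n ->; rewrite bM.
have pM x y : p (x * y) = p x * p y.
  suff : closure P `<=` [set f | f (x * y) = f x * f y] by apply.
  have -> : [set f : F | f (x * y) = f x * f y] =
      (fun f : F => (f (x * y))^-1 * (f x * f y)) @^-1` [set 1].
    apply/seteqP; split=> f /=; first by move=> ->; rewrite mulVg.
    by move=> /eqP; rewrite mulg_eq1 => /eqP/invg_inj.
  apply: limP.
    apply: closed_comp => // f _.
    have evM := continuousM (evC x) (evC y).
    exact: (continuousM (continuousV (evC (x * y))) evM).
  by move=> _ [n _ <-]; rewrite /preimage /mkset iterM mulVg.
have pb x : exists y, p x = b y.
  have : closure P `<=` [set f | (b @` setT) (f x)].
    apply: limP; last by move=> _ [n _ <-]; exists (iter n b x).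
    apply: (closed_comp (f := fun f : F => f x)).
      by move=> f _; exact: evC.
    by apply: compact_closed => //; exact: compact_image.
  by move=> /(_ p Pp)[y _ <-]; exists y.
move=> x.
pose z := (p x)^-1 * x.
have z1 : z = 1.
  apply: distb.
  have pz : p z = 1.
    have pp : p (p x) = p x by rewrite -[in RHS]ppp.
    by apply: (@mulgI _ (p x)); rewrite -{1}pp -pM mulVKg mulg1.
  have : closure P `<=` [set f | closure [set iter n.+1 b z | n in setT] (f z)].
    apply: limP.
      apply: (closed_comp (f := fun f : F => f z)).
        by move=> f _; exact: evC.
      exact: closed_closure.
    by move=> _ [n _ <-]; apply: subset_closure; exists n.
  by move=> /(_ p Pp) /=; rewrite pz.
have [y py] := pb x; exists y; rewrite -py.
by rewrite -[LHS](mulVKg (p x)) -/z z1 mulg1.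
Qed.
End CompactEndomorphism.



(** * Distal elements *)

Section Distal.
Context {G : topologicalGroupType}.

(** Invariance of [W] under conjugation by [g^-1] is surjectivity of conjugation
by [g] on [W], to which the result on compact groups applies. *)
Lemma distal_contraction_surjective (g : G) (W : subgroup G) :
  hausdorff_space G -> compact W ->
  (forall x, closure [set iter n.+1 (conjl g) x | n in [set: nat]] 1 -> x = 1) ->
  (forall x, subgroup_set W x -> subgroup_set W (conjl g x)) ->
  forall x, subgroup_set W x -> subgroup_set W (conjl g^-1 x).
Proof.
move=> hG cW dg gW x Wx.
pose b (w : set_type W) : set_type W :=
  SigSub (mem_set (gW _ (set_mem (valP w)))).
have bC : continuous b.
  apply: continuous_set_type => w.
  have vC := @set_type_val_continuous _ _ w.
  exact: (continuous_comp vC (@conjl_continuous _ g _)).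
have bM w z : b (w * z) = b w * b z by apply: val_inj; exact: conjlM.
have [w|y xy] := compact_endomorphism_surjective (set_type_hausdorff hG)
    (set_type_compactT cW) bC bM _ (SigSub (mem_set Wx)).
  move=> /set_type_closure clw; apply: val_inj; apply: dg.
  apply: closureS clw => _ [_ [n _ <-] <-]; exists n => //.
  by elim: n.+1 => //= m ->.
have -> : x = conjl g (val y) by have := congr1 val xy.
by rewrite conjlK; exact: set_mem (valP y).
Qed.

Lemma expgzN (g : G) n : expgz g (- n)%R = (expgz g n)^-1.
Proof. by case: n => [[|n]|n] //=; rewrite ?invg1 ?invgK. Qed.

Lemma distal_element_iter (g x : G) : distal_element g ->
  closure [set iter n.+1 (conjl g) x | n in [set: nat]] 1 -> x = 1.
Proof.
move=> dg clx; apply: contrapT => x1; apply: (dg x x1).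
apply: closureS clx => _ [n _ <-]; exists (Posz n.+1) => //.
by rewrite expgzN -conjXl.
Qed.

Lemma distal_element_iterV (g x : G) : distal_element g ->
  closure [set iter n.+1 (conjl g^-1) x | n in [set: nat]] 1 -> x = 1.
Proof.
move=> dg clx; apply: contrapT => x1; apply: (dg x x1).
apply: closureS clx => _ [n _ <-]; exists (Negz n) => //.
by rewrite expgzN -conjXl expVgn.
Qed.

(** Write [A N] for the intersection of the [g^i U g^-i] with [i] in [N].  The
group [A setT] is mapped into itself by conjugation with [g^-1], hence is
invariant, so it lies in [g^-1 U g].  By compactness so does [A N] for an initial
segment [N] of the naturals, and then [g (A N) g^-1] is contained in [A N];
distality again makes this an equality. *)
Lemma distal_element_normalizes (g : G) (U : subgroup G) :
  hausdorff_space G -> distal_element g -> open U -> compact U ->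
  exists V : subgroup G, [/\ open V, V `<=` U &
    forall x, subgroup_set V x ->
      subgroup_set V (conjl g x) /\ subgroup_set V (conjl g^-1 x)].
Proof.
move=> hG dg oU cU.
pose A (N : set nat) :=
  [set x | forall i, N i -> subgroup_set U (iter i (conjl g^-1) x)].
have iM i x y : iter i (conjl g^-1) (x * y) =
    iter i (conjl g^-1) x * iter i (conjl g^-1) y.
  by rewrite -!conjXl conjlM.
have A1 N : A N 1 by move=> i _; rewrite -conjXl conjl1; exact: subgroup1.
have AM N x y : A N x -> A N y -> A N (x * y).
  by move=> Ax Ay i Ni; rewrite iM; apply: subgroupM; [exact: Ax|exact: Ay].
have AV N x : A N x -> A N x^-1.
  by move=> Ax i Ni; rewrite -conjXl conjlV conjXl; apply/subgroupV/Ax.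
pose S N := make_subgroup (A1 N) (AM N) (AV N).
have clU := subgroup_open_closed oU.
have clA N : closed (A N).
  rewrite (_ : A N = \bigcap_(i in N) iter i (conjl g^-1) @^-1` U).
    apply: closed_bigI => i _; apply: closed_comp clU => x _.
    rewrite -conjXl; exact: conjl_continuous.
  by apply/seteqP; split=> x Ax i Ni; exact: Ax.
have AU N : N 0%N -> A N `<=` U by move=> N0 x /(_ 0%N N0).
have cA N : N 0%N -> compact (A N).
  by move=> N0; apply: subclosed_compact cU (AU N N0).
have gA x : A setT x -> A setT (conjl g x).
  have := @distal_contraction_surjective g^-1 (S setT) hG (cA _ I).
  rewrite invgK; apply => y; first exact: distal_element_iterV.
  by move=> Ay i _; rewrite -iterSr; exact: Ay.
have [n AnU] : exists n, A [set i | (i <= n)%N] `<=` conjl g @^-1` U.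
  apply: contrapT => nA.
  have [|i _|i j _ _|i _|x [_ Ax]] := @compact_directed _ nat setT
    (fun n => A [set i | (i <= n)%N] `\` conjl g @^-1` U) _ cU.
  - by exists 0%N.
  - apply: closedI => //; apply: open_closedC; apply: open_comp oU => x _.
    exact: conjl_continuous.
  - exists (maxn i j) => // x [Ax nUx]; split; split=> // k ki; apply: Ax;
      rewrite /= leq_max ki ?orbT //.
  - apply: contrapT => UA0; apply: nA; exists i => x Ax; apply: contrapT => nUx.
    by apply: UA0; exists x; split; [exact: (AU _ _ x Ax)|split].
  have [_] := Ax 0%N I; apply; apply: (AU setT I); apply: gA => i _.
  by have [+ _] := Ax i I; apply => /=.
pose N := [set i | (i <= n)%N].
have gN x : A N x -> A N (conjl g x).
  move=> Ax [_|i ni]; first exact: AnU.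
  by rewrite iterSr conjlK; apply: Ax; exact: ltnW.
exists (S N); split.
- apply: subgroup_open.
  have nU i : nbhs (1 : G) [set x | subgroup_set U (iter i (conjl g^-1) x)].
    have := @conjl_continuous _ (g^-1 ^+ i) 1.
    rewrite /continuous_at conjl1 conjXl.
    by apply; apply: open_nbhs_nbhs; split=> //; exact: subgroup1.
  rewrite /= /N; elim: n {AnU N gN} => [|n ih].
    by apply: filterS (nU 0%N) => x Ux i; rewrite /mkset leqn0 => /eqP ->.
  apply: filterS (filterI ih (nU n.+1)) => x [Ax Ux] i.
  by rewrite /mkset leq_eqVlt ltnS => /orP[/eqP -> //|]; exact: Ax.
- exact: AU.
- move=> x Sx; split; first exact: gN.
  apply: (@distal_contraction_surjective g (S N)) => //; first exact: cA.
  by move=> y; exact: distal_element_iter.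
Qed.
End Distal.


(** * Product ideals of subsets of a group *)

Definition mulset (G : groupType) (A B : set G) : set G :=
  [set a * b | a in A & b in B].

Record product_ideal (G : topologicalGroupType) (I : set G -> Prop) := {
  ideal_sub : forall A B, A `<=` B -> I B -> I A;
  ideal_union : forall A B, I A -> I B -> I (A `|` B);
  ideal_mul : forall A B, I A -> I B -> I (mulset A B);
  ideal_compact : forall K, compact K -> I K
}.

Lemma compact_mulset (G : topologicalGroupType) (A B : set G) :
  compact A -> compact B -> compact (mulset A B).
Proof.
move=> cA cB; have cAB := compact_setX cA cB.
have := compact_image (@mulg_continuous G) cAB.
congr compact; apply/seteqP; split=> [_ [[a b] [/= Aa Bb] <-]|].
  by exists a => //; exists b.
by move=> _ [a Aa [b Bb <-]]; exists (a, b).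
Qed.

Lemma mulset_clopen (G : topologicalGroupType) (A : set G) (V : subgroup G) :
  open V -> clopen (mulset A V).
Proof.
move=> oV.
have AVV x v : mulset A V x -> subgroup_set V v -> mulset A V (x * v).
  move=> [a Aa [w Vw <-]] Vv; exists a => //.
  exists (w * v); last by rewrite mulgA.
  exact: subgroupM.
split; last exact: coset_saturated_closed oV AVV.
rewrite openE => x AVx; apply: filterS (coset_nbhs x oV) => y Vxy.
by rewrite -(mulVKg x y); exact: AVV.
Qed.

Lemma compact_invset (G : topologicalGroupType) (A : set G) :
  compact A -> compact [set x^-1 | x in A].
Proof. by move=> cA; apply: compact_image => //; exact: invg_continuous. Qed.

(** The smallest product ideal.  Working with it rather than with precompactness
avoids closures and separation axioms. *)
Definition bounded (G : topologicalGroupType) (A : set G) :=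
  exists2 K, compact K & A `<=` K.

Lemma bounded_ideal (G : topologicalGroupType) : product_ideal (@bounded G).
Proof.
split.
- by move=> A B AB [K cK BK]; exists K => // x /AB/BK.
- move=> A B [K cK AK] [L cL BL]; exists (K `|` L); first exact: compactU.
  exact: setUSS.
- move=> A B [K cK AK] [L cL BL].
  exists (mulset K L); first exact: compact_mulset.
  by move=> _ [a /AK Ka [b /BL Lb <-]]; exists a => //; exists b.
- by move=> K cK; exists K.
Qed.

Definition conj_equicontinuous (G : topologicalGroupType) (A : set G) :=
  forall U : set G, nbhs (1 : G) U ->
    nbhs (1 : G) [set x | forall a, A a -> U (conjl a x)].

Lemma conj_equicontinuous_ideal (G : topologicalGroupType) :
  product_ideal (@conj_equicontinuous G).
Proof.
split.
- by move=> A B AB eB U /eB; apply: filterS => x Ux a /AB; exact: Ux.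
- move=> A B eA eB U U1; apply: filterS (filterI (eA U U1) (eB U U1)).
  by move=> x [UA UB] a [/UA|/UB].
- move=> A B eA eB U /eA/eB; apply: filterS => x Ux _ [a Aa [b Bb <-]].
  by rewrite conjlMl; exact: Ux.
- move=> K cK U U1.
  apply: (compact_tube (P := [set p | U (conjl p.1 p.2)]) cK) => a Ka.
  have h : (fun p : G * G => conjl p.1 p.2) @ (a, 1) --> (1 : G).
    rewrite -{2}(conjl1 a); apply: cvgM.
      by apply: cvgM; [exact: cvg_fst|exact: cvg_snd].
    by apply: cvgV; exact: cvg_fst.
  exact: h.
Qed.

(** * Sorting words *)

Inductive word (G : groupType) (A : set G) : nat -> G -> Prop :=
| word_nil : word A 0 1
| word_cons n a x : A a -> word A n x -> word A n.+1 (a * x).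

Definition words (G : groupType) (A : set G) : set G :=
  [set x | exists n, word A n x].

Section Words.
Context {G : groupType}.
Implicit Types (A B C D : set G).

Lemma wordM A m n x y : word A m x -> word A n y -> word A (m + n) (x * y).
Proof.
move=> Ax Ay; elim: Ax => [|k a {}x Aa _ ih]; first by rewrite mul1g.
by rewrite -mulgA addSn; exact: word_cons.
Qed.

Lemma words1 A : words A 1. Proof. by exists 0%N; exact: word_nil. Qed.

Lemma words_sub A : A `<=` words A.
Proof.
move=> x Ax; exists 1%N; rewrite -[x]mulg1.
by apply: word_cons => //; exact: word_nil.
Qed.

Lemma wordsM A x y : words A x -> words A y -> words A (x * y).
Proof. by move=> [m Ax] [n Ay]; exists (m + n)%N; exact: wordM. Qed.

Lemma wordsV A x : (forall a, A a -> A a^-1) -> words A x -> words A x^-1.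
Proof.
move=> AV [n]; elim=> [|k a {}x Aa _ ih]; first by rewrite invg1; exact: words1.
by rewrite invgM; apply: wordsM => //; apply/words_sub/AV.
Qed.

(** Moving the second letter [c] to the front conjugates the first one. *)
Lemma word_commute B n b c x : (forall a b, B a -> B b -> B (b^-1 * a * b)) ->
  B b -> B c -> word B n x -> exists2 x', word B n.+1 x' & b * (c * x) = c * x'.
Proof.
move=> BJ Bb Bc Bx; exists ((c^-1 * b * c) * x).
  by apply: word_cons => //; exact: BJ.
by rewrite !mulgA mulgV mul1g.
Qed.

Inductive finite_union (P : set (set G)) : set G -> Prop :=
| finite_union0 : finite_union P set0
| finite_unionU C A : P C -> finite_union P A -> finite_union P (C `|` A).

Lemma finite_unionUU P A B :
  finite_union P A -> finite_union P B -> finite_union P (A `|` B).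
Proof.
move=> fA fB; elim: fA => [|C A' PC _ ih]; first by rewrite set0U.
by rewrite -setUA; exact: finite_unionU.
Qed.

End Words.

Section Collecting.
Context {G : topologicalGroupType} (I : set G -> Prop) (idI : product_ideal I).
Context (B : set G) (BJ : forall a b, B a -> B b -> B (b^-1 * a * b)).

(** [D] is the union of the pieces of the cover already collected.  A letter can
always be moved to the front, so looking at first letters only is the same as
asking that no word of length [n] for [x] has a letter in [D]. *)
Definition irreducible D : set G :=
  [set x | exists2 n, word B n x &
    forall m c y, B c -> D c -> word B m y -> n = m.+1 -> x <> c * y].

(** Collection of the letters, one piece [C] of the cover at a time: as long as
an element irreducible for [D] has a word with a letter in [C], that letter is
pulled out to the left, and the shorter rest is still irreducible for [D]. *)
Lemma ideal_irreducible (A D : set G) :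
  finite_union (fun C => I (words C)) A -> B `<=` D `|` A -> I (irreducible D).
Proof.
move=> fA; elim: fA D => [D|C {}A IC _ ih D] BDA.
  have I1 : I [set 1] by exact/(ideal_compact idI)/compact_set1.
  apply: (ideal_sub idI) I1.
  move=> x [_ [//|n b y Bb By] irr]; exfalso.
  apply: (irr n b y) => //.
  by case: (BDA b Bb).
pose CD := mulset (words C) (irreducible (D `|` C)).
apply: (ideal_sub idI (B := CD)); last first.
  by apply: (ideal_mul idI) => //; apply: ih; rewrite -setUA.
move=> x [n]; elim: n x => [|n ihn] x Bx irr.
  exists 1; first exact: words1.
  by exists x; [exists 0%N | rewrite mul1g].
have [irr'|] := pselect (irreducible (D `|` C) x).
  by exists 1; [exact: words1 | exists x => //; rewrite mul1g].
move=> nirr; apply: contrapT => nx; apply: nirr; exists n.+1 => //.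
move=> m c y Bc DCc By [mn] xE; subst m; apply: nx.
case: DCc => [Dc|Cc]; first by case: (irr n c y).
have [|p Cp [z irrz pz]] := ihn y By.
  move=> m d w Bd Dd Bw nE yE; subst n y.
  have [w' Bw' cdw] := word_commute BJ Bc Bd Bw.
  by apply: (irr m.+1 d w') => //; rewrite xE.
exists (c * p); last by exists z => //; rewrite xE -pz mulgA.
by apply: wordsM => //; exact: words_sub.
Qed.

Lemma ideal_words (K : set G) : compact K -> B `<=` K ->
  (forall x, K x -> exists2 C, nbhs x C & I (words C)) -> I (words B).
Proof.
move=> cK BK locK.
suff [A fA KA] : exists2 A, finite_union (fun C => I (words C)) A & K `<=` A.
  apply: (ideal_sub idI (B := irreducible set0)).
    by move=> x [n Bx]; exists n.
  by apply: ideal_irreducible fA _; rewrite set0U => x /BK/KA.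
apply: (compact_ideal (I := fun K => exists2 A, _ A & K `<=` A)) cK _ _.
- by move=> L M LM [A fA MA]; exists A => // x /LM/MA.
- move=> L M [A fA LA] [A' fA' MA']; exists (A `|` A'); last exact: setUSS.
  exact: finite_unionUU.
- by exists set0 => //; exact: finite_union0.
- move=> x /locK[C xC IC]; exists C => //.
  exists (C `|` set0); last by rewrite setU0.
  by apply: finite_unionU => //; exact: finite_union0.
Qed.

(** [f v f^n w = f^(n+1) (f^-n v f^n) w]: the powers of [f] gather on the left. *)
Lemma words_coset (f : G) (W : subgroup G) :
  (forall x, subgroup_set W x -> subgroup_set W (conjl f^-1 x)) ->
  words [set x | subgroup_set W (f^-1 * x)] `<=`
    mulset [set f ^+ n | n in [set: nat]] W.
Proof.
move=> Wf x [n]; elim=> [|m a {}x Wa _ [_ [k _ <-] [w Ww <-]]].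
  by exists 1; [exists 0%N|exists 1; [exact: subgroup1|rewrite mulg1]].
exists (f ^+ k.+1); first by exists k.+1.
exists (conjl (f^-1 ^+ k) (f^-1 * a) * w).
  apply: subgroupM => //.
  by elim: k => [|k ih]; rewrite ?conj1l // expgS conjlMl; exact: Wf.
by rewrite /conjl expVgn invgK expgS !mulgA mulgK mulgV mul1g.
Qed.

End Collecting.


(** * Compactly generated groups with precompact conjugacy classes *)

Section FC.
Context {Q : topologicalGroupType} (lpQ : locally_profinite Q).

(** Baire category theorem for a compact open subgroup. *)
Lemma baire_coset (V : subgroup Q) (A : nat -> set Q) :
  open V -> compact V -> (forall n, closed (A n)) -> V `<=` \bigcup_n A n ->
  exists n (x : Q), nbhs x (A n).
Proof.
move=> oV cV clA VA; apply: contrapT => nA.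
pose P O := [/\ open O, closed O, O !=set0 & O `<=` V].
have shrink (nO : nat * set Q) :
    exists O', P nO.2 -> P O' /\ O' `<=` nO.2 `\` A nO.1.
  case: nO => n O /=.
  have [[oO cO [x Ox] OV]|] := pselect (P O); last by exists O.
  have [y [Oy nAy]] : O `\` A n !=set0.
    apply: contrapT => OA; apply: nA; exists n, x.
    apply: filterS (open_nbhs_nbhs (conj oO Ox)) => y Oy.
    by apply: contrapT => nAy; apply: OA; exists y.
  have /nbhs_mulgl1/lpQ[W [oW _ WOA]] : nbhs y (O `\` A n).
    apply: open_nbhs_nbhs; split=> //.
    by apply: openI => //; exact: closed_openC.
  have yW : [set z | subgroup_set W (y^-1 * z)] `<=` O `\` A n.
    by move=> z /WOA; rewrite /mkset mulVKg.
  exists [set z | subgroup_set W (y^-1 * z)] => _; split=> //; split.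
  - by apply: open_comp oW => z _; exact: mulgl_continuous.
  - apply: closed_comp (subgroup_open_closed oW) => z _.
    exact: mulgl_continuous.
  - by exists y; rewrite /mkset mulVg; exact: subgroup1.
  - by move=> z /yW[/OV].
have [f Pf] := choice shrink.
pose O := fix O n := if n is m.+1 then f (m, O m) else V : set Q.
have PO n : P (O n).
  elim: n => [|n ih]; last by have [] := Pf (n, O n) ih.
  by split=> //; [exact: subgroup_open_closed|exists 1; exact: subgroup1].
have OS n : O n.+1 `<=` O n `\` A n by have [] := Pf (n, O n) (PO n).
have Ole m n : (m <= n)%N -> O n `<=` O m.
  by move/subnK => <-; elim: (n - m)%N => // k ih x /OS[/ih].
have [|n _|i j _ _|n _|x [Vx Ox]] := @compact_directed _ nat setT O _ cV.
- by exists 0%N.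
- by case: (PO n).
- exists (maxn i j) => // x Ox.
  by split; apply: Ole Ox; [exact: leq_maxl | exact: leq_maxr].
- by have [_ _ [x Ox] OV] := PO n; exists x; split=> //; exact: OV.
have [n _ Anx] := VA x Vx.
by have [_] := OS n x (Ox n.+1 I).
Qed.

Hypotheses (cgQ : compactly_generated Q) (pcQ : precompact_conjugacy_classes Q).

Definition conj_saturation (A : set Q) : set Q :=
  [set conjl g.1 g.2 | g in setT `*` A].

Lemma bounded_conjugacy_class x : bounded (conj_saturation [set x]).
Proof.
have [K xK [cK _]] := pcQ x; exists K => // _ [[g _] [_ /= ->] <-].
by apply: xK; exists g.
Qed.

Lemma generated_words (A : set Q) (K : set Q) :
  smallest (fun A : set Q => group_closed (mem A)) K = [set: Q] ->
  K `<=` A -> (forall a, A a -> A a^-1) -> words A = [set: Q].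
Proof.
move=> genK KA AV; apply/seteqP; split=> // x _.
have : smallest (fun A : set Q => group_closed (mem A)) K x by rewrite genK.
apply; split; last by move=> y /KA; exact: words_sub.
split; first by rewrite inE; exact: words1.
by move=> y z; rewrite !inE => Ay Az; apply: wordsM => //; exact: wordsV.
Qed.

(** A compactly generated group is hemicompact: the sets of words of length [n] in
a compact generating set, thickened by a compact open subgroup to make them open
and closed, eventually contain every bounded set. *)
Lemma exhaustion : exists C : nat -> set Q, [/\ forall n, clopen (C n),
  forall n, compact (C n) & forall A, bounded A -> exists n, A `<=` C n].
Proof.
have [K cK genK] := cgQ.
have [V [oV cV _]] := lpQ (@filterT _ (nbhs (1 : Q)) _).
pose S := K `|` [set x^-1 | x in K] `|` V.
have cS : compact S.
  by apply: compactU => //; apply: compactU => //; exact: compact_invset.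
have SV x : S x -> S x^-1.
  case=> [[Kx|[y Ky <-]]|Vx]; first by left; right; exists x.
    by left; left; rewrite invgK.
  by right; exact: subgroupV.
have KS : K `<=` S by move=> x Kx; left; left.
have wS := generated_words genK KS SV.
have cW n : compact [set x | word S n x].
  elim: n => [|n ih].
    rewrite (_ : mkset _ = [set 1]); first exact: compact_set1.
    apply/seteqP; split=> x; last by move=> ->; exact: word_nil.
    by rewrite /mkset => Sx; inversion Sx.
  rewrite (_ : mkset _ = mulset S [set x | word S n x]).
    exact: compact_mulset.
  apply/seteqP; split=> x.
    by rewrite /mkset => Sx; inversion Sx; subst; exists a => //; exists x0.
  by move=> [a Sa [y Sy <-]]; exact: word_cons.
pose C n := mulset [set x | word S n x] V.
have CS n : C n `<=` C n.+1.
  move=> _ [x Sx [v Vv <-]]; exists x; last by exists v.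
  by rewrite -[x]mul1g; apply: word_cons => //; right; exact: subgroup1.
have Cle m n : (m <= n)%N -> C m `<=` C n.
  by move/subnK => <-; elim: (n - m)%N => // k ih x /ih/CS.
have CT x : exists n, C n x.
  have [n Sx] : words S x by rewrite wS.
  by exists n, x => //; exists 1; [exact: subgroup1|rewrite mulg1].
exists C; split=> [n|n|A [L cL AL]].
- exact: mulset_clopen.
- exact: compact_mulset.
suff [n LC] : exists n, L `<=` C n by exists n => x /AL/LC.
apply: (compact_ideal (I := fun L => exists n, L `<=` C n)) cL _ _.
- by move=> M N MN [n NC]; exists n => x /MN/NC.
- move=> M N [m MC] [n NC]; exists (maxn m n) => x [/MC|/NC].
    by apply: Cle; exact: leq_maxl.
  by apply: Cle; exact: leq_maxr.
- by exists 0%N.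
- move=> x _; have [n Cx] := CT x; exists (C n); last by exists n.
  by apply: open_nbhs_nbhs; split=> //; exact: (mulset_clopen _ oV).1.
Qed.

(** The elements all of whose conjugates lie in [C n] form closed sets that
exhaust the group, since conjugacy classes are bounded; so one of them contains
a coset [x V], and then the conjugates of [V] lie in [C n ^-1 C n]. *)
Lemma bounded_conj_saturation_subgroup :
  exists V : subgroup Q, [/\ open V, compact V & bounded (conj_saturation V)].
Proof.
have [C [clC cC bC]] := exhaustion.
have [V0 [oV0 cV0 _]] := lpQ (@filterT _ (nbhs (1 : Q)) _).
pose A n := [set v | forall g, C n (conjl g v)].
have clA n : closed (A n).
  rewrite (_ : A n = \bigcap_(g in setT) conjl g @^-1` C n).
    apply: closed_bigI => g _; apply: closed_comp (clC n).2 => x _.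
    exact: conjl_continuous.
  by apply/seteqP; split=> x Ax g *; exact: Ax.
have [|n [x /nbhs_mulgl1/lpQ[V [oV cV VA]]]] := baire_coset oV0 cV0 clA.
  move=> v _; have [n nv] := bC _ (bounded_conjugacy_class v).
  by exists n => // g; apply: nv; exists (g, v).
exists V; split=> //.
exists (mulset [set c^-1 | c in C n] (C n)).
  by apply: compact_mulset => //; exact: compact_invset.
move=> _ [[g v] [/= _ Vv] <-].
have Cx : C n (conjl g x).
  by have := VA 1 (subgroup1 V); rewrite /mkset mulg1; apply.
exists (conjl g x)^-1; first by exists (conjl g x).
exists (conjl g (x * v)); first exact: VA.
by rewrite conjlM mulKg.
Qed.

(** The set [B] of the elements [x] for which all conjugates of all powers lie in
a fixed compact set [C] is compact, invariant, contains the conjugates of [V],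
and every cyclic group generated in it is bounded.  Each [f] in [B] normalizes
(in one direction) a small open subgroup, because [B] is
conjugation-equicontinuous.  Sorting words therefore bounds the group generated
by [B]. *)
Lemma bounded_open_normal_subgroup : exists H : subgroup Q,
  [/\ open H, bounded H &
    forall g x, subgroup_set H x -> subgroup_set H (conjl g x)].
Proof.
have [V [oV cV [K cK VK]]] := bounded_conj_saturation_subgroup.
pose C0 := mulset K V.
have clC0 : closed C0 := (mulset_clopen K oV).2.
have cC0 : compact C0 by exact: compact_mulset.
pose C := C0 `|` [set x^-1 | x in C0].
have CV x : C x -> C x^-1.
  by case=> [Cx|[y Cy <-]]; [right; exists x | left; rewrite invgK].
have cC : compact C by apply: compactU => //; exact: compact_invset.
have clC : closed C.
  apply: closedU => //; rewrite (_ : image _ _ = (fun x => x^-1) @^-1` C0).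
    by apply: closed_comp clC0 => x _; exact: invg_continuous.
  apply/seteqP; split=> [_ [x Cx <-]|x Cx].
    by rewrite /preimage /mkset invgK.
  by exists x^-1 => //; rewrite invgK.
pose B := [set x : Q | forall g k, C (conjl g (x ^+ k))].
have VB : V `<=` B.
  move=> v Vv g k; left; rewrite -[conjl _ _]mulg1.
  exists (conjl g (v ^+ k)); last by exists 1 => //; exact: subgroup1.
  apply: VK; exists (g, v ^+ k) => //; split=> //=.
  by elim: k => [|k ih]; [exact: subgroup1|rewrite expgS; exact: subgroupM].
have BJ x g : B x -> B (conjl g x).
  by move=> Bx h k; rewrite -conjlX -conjlMl; exact: Bx.
have BV x : B x -> B x^-1.
  by move=> Bx g k; rewrite expVgn conjlV; exact/CV/Bx.
have BX x k : B x -> B (x ^+ k).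
  by move=> Bx g m; rewrite -expgnA; exact: Bx.
have BC : B `<=` C by move=> x /(_ 1 1%N); rewrite conj1l.
have XC k : continuous (fun x : Q => x ^+ k).
  elim: k => [|k ih]; first by move=> x; exact: cvg_cst.
  rewrite (_ : (fun x : Q => x ^+ k.+1) = (fun x : Q => x * x ^+ k)).
    by apply: continuousM => // x; exact: cvg_id.
  by apply/funext => x; rewrite expgS.
have clB : closed B.
  rewrite (_ : B = \bigcap_(gk in setT)
      (fun x => conjl gk.1 (x ^+ gk.2)) @^-1` C).
    apply: closed_bigI => -[g k] _; apply: closed_comp clC => x _ /=.
    exact: (continuous_comp (@XC k x) (@conjl_continuous _ g _)).
  apply/seteqP; split=> [x Bx [g k] _|x Bx g k]; first exact: Bx.
  exact: (Bx (g, k)).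
have cB : compact B by exact: subclosed_compact cC BC.
have bB : bounded B by exists B.
have bwB : bounded (words B).
  apply: (ideal_words (bounded_ideal Q) _ cB) => //.
    by move=> a b Ba _; have := BJ a b^-1 Ba; rewrite /conjl invgK.
  move=> f Bf.
  pose D := [set x | forall k, subgroup_set V (conjl (f^-1 ^+ k) x)].
  have D1 : D 1 by move=> k; rewrite conjl1; exact: subgroup1.
  have DM x y : D x -> D y -> D (x * y).
    by move=> Dx Dy k; rewrite conjlM; apply: subgroupM; [exact: Dx|exact: Dy].
  have DV x : D x -> D x^-1 by move=> Dx k; rewrite conjlV; exact/subgroupV/Dx.
  pose W := make_subgroup D1 DM DV.
  have oW : open W.
    apply: subgroup_open.
    have V1 : nbhs (1 : Q) V.
      by apply: open_nbhs_nbhs; split=> //; exact: subgroup1.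
    have eB := ideal_compact (conj_equicontinuous_ideal Q) cB.
    apply: filterS (eB _ V1) => x Vx k.
    by apply: Vx; apply/BX/BV.
  exists [set x | subgroup_set W (f^-1 * x)]; first exact: coset_nbhs.
  apply: (ideal_sub (bounded_ideal Q)) (@words_coset _ f W _) _.
    by move=> x Dx k; rewrite -conjlMl -expgSr; exact: Dx.
  apply: (ideal_mul (bounded_ideal Q)).
    by exists B => // _ [k _ <-]; exact: BX.
  by exists V => // x /(_ 0%N); rewrite conj1l.
pose H := make_subgroup (words1 B) (@wordsM _ B) (fun x => @wordsV _ B x BV).
exists H; split=> //.
  apply: subgroup_open; apply: (filterS (P := subgroup_set V)).
    by move=> x /VB; exact: words_sub.
  by apply: open_nbhs_nbhs; split=> //; exact: subgroup1.
move=> g x [n]; elim=> [|k a {}x Ba _ ih].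
  by rewrite conjl1; exact: words1.
by rewrite conjlM; apply: wordsM => //; apply/words_sub/BJ.
Qed.

(** The conjugates of a compact generating set lie in finitely many cosets of the
bounded open normal subgroup [H], and words in them are sorted into a product of
sets [{f^n | n} H]. *)
Theorem product_ideal_FC_group (I : set Q -> Prop) : product_ideal I ->
  (forall x, I [set expgz x n | n in [set: int]]) -> I [set: Q].
Proof.
move=> idI cycI.
have [H [oH bH HJ]] := bounded_open_normal_subgroup.
have idb := bounded_ideal Q.
have [K cK genK] := cgQ.
have bJK : bounded (conj_saturation K).
  apply: (compact_ideal (I := fun K => bounded (conj_saturation K))) cK _ _.
  - move=> A A' AA'; apply: (ideal_sub idb) => _ [[g x] [_ /= /AA' A'x] <-].
    by exists (g, x).
  - move=> A A' bA bA'; apply: (ideal_sub idb) (ideal_union idb bA bA').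
    by move=> _ [[g x] [_ [Ax|Ax]] <-]; [left|right]; exists (g, x).
  - by exists set0; [exact: compact0|move=> x [[g y] [_ []]]].
  - move=> k _; exists [set x | subgroup_set H (k^-1 * x)].
      exact: coset_nbhs.
    apply: (ideal_sub idb) (ideal_mul idb (bounded_conjugacy_class k) bH).
    move=> _ [[g x] [_ /= Hx] <-]; exists (conjl g k); first by exists (g, k).
    exists (conjl g (k^-1 * x)); first exact: HJ.
    by rewrite -conjlM mulVKg.
have [L cL JKL] := bJK.
pose B := conj_saturation K `|` [set x^-1 | x in conj_saturation K].
have BJ x g : B x -> B (conjl g x).
  have KJ y : conj_saturation K y -> conj_saturation K (conjl g y).
    by move=> [[h z] [_ Kz] <-]; exists (g * h, z) => //=; rewrite conjlMl.
  case=> [/KJ|[y /KJ Ky <-]]; first by left.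
  by right; exists (conjl g y) => //; rewrite conjlV.
have BV x : B x -> B x^-1.
  by case=> [Kx|[y Ky <-]]; [right; exists x | left; rewrite invgK].
rewrite -(generated_words genK _ BV); last first.
  by move=> x Kx; left; exists (1, x) => //=; rewrite conj1l.
apply: (@ideal_words _ _ idI B _ (L `|` [set x^-1 | x in L])) => //.
- by move=> a b Ba _; have := BJ a b^-1 Ba; rewrite /conjl invgK.
- by apply: compactU => //; exact: compact_invset.
- by move=> x [/JKL|[y /JKL Ly <-]]; [left|right; exists y].
move=> f _; exists [set x | subgroup_set H (f^-1 * x)]; first exact: coset_nbhs.
apply: (ideal_sub idI) (@words_coset _ f H _) _; first by move=> x; exact: HJ.
apply: (ideal_mul idI).
  by apply: (ideal_sub idI) (cycI f) => _ [n _ <-]; exists (Posz n).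
have [M cM HM] := bH.
exact: (ideal_sub idI HM (ideal_compact idI cM)).
Qed.

End FC.


(** * Extensions *)

Lemma locally_profinite_subgroup (G : topologicalGroupType) (H : subgroup G) :
  closed H -> locally_profinite G -> locally_profinite (set_type H).
Proof.
move=> clH lpG U /set_type_nbhs[O O1 OU].
have [V [oV cV VO]] := lpG O O1.
have T1 : (val @^-1` V : set (set_type H)) 1 by exact: (subgroup1 V).
have TM (x y : set_type H) :
    (val @^-1` V) x -> (val @^-1` V) y -> (val @^-1` V) (x * y).
  exact: subgroupM.
have TV (x : set_type H) : (val @^-1` V) x -> (val @^-1` V) x^-1.
  exact: subgroupV.
exists (make_subgroup T1 TM TV); split.
- by apply: open_comp oV => x _; exact: set_type_val_continuous.
- apply: set_type_compact; rewrite (_ : image _ _ = V `&` H).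
    exact: compact_closedI.
  apply/seteqP; split=> [_ [x Vx <-]|x [Vx Hx]].
    by split=> //; exact: set_mem (valP x).
  by exists (SigSub (mem_set Hx)).
- by move=> x /VO/OU.
Qed.

Lemma locally_profinite_quotient (G : topologicalGroupType)
    (N : normal_subgroup G) :
  locally_profinite G -> locally_profinite (quotient_group N).
Proof.
move=> lpG U U1; set Q := quotient_group N.
have [V [oV cV VU]] := lpG _ (@quotient_pi_continuous _ N 1 _ U1).
pose A : set Q := \pi_Q @` V.
have A1 : A 1 by exists 1 => //; exact: subgroup1.
have AM x y : A x -> A y -> A (x * y).
  move=> [v Vv <-] [w Vw <-]; exists (v * w); first exact: subgroupM.
  by rewrite quotient_piM.
have AV x : A x -> A x^-1.
  by move=> [v Vv <-]; exists v^-1; [exact: subgroupV|rewrite quotient_piV].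
exists (make_subgroup A1 AM AV); split.
- exact: quotient_pi_open.
- exact: (compact_image (@quotient_pi_continuous _ N)).
- by move=> _ [v Vv <-]; exact: VU.
Qed.

(** The sets of cosets whose preimage is conjugation-equicontinuous form a product
ideal of the quotient: compact sets and cyclic groups lift, up to a factor [N],
to compact sets and cyclic groups. *)
Lemma conj_equicontinuous_extension (G : topologicalGroupType) (H : subgroup G)
    (N : normal_subgroup G) :
  locally_profinite G -> closed H ->
  (forall g : G, conj_equicontinuous [set expgz g n | n in [set: int]]) ->
  let Q := quotient_group (subgroup_trace H N) in
  compactly_generated Q -> precompact_conjugacy_classes Q ->
  conj_equicontinuous (N : set G) -> conj_equicontinuous (H : set G).
Proof.
move=> lpG clH cycG Q cgQ pcQ eN.
have idE := conj_equicontinuous_ideal G.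
pose lift (A : set Q) : set G :=
  [set val h | h in [set h : set_type H | A (\pi_Q h)]].
have lpH := locally_profinite_subgroup clH lpG.
have lpQ : locally_profinite Q by exact: locally_profinite_quotient.
have liftN (A : set Q) (B : set (set_type H)) :
    A `<=` \pi_Q @` B -> lift A `<=` mulset (val @` B) N.
  move=> AB _ [h /AB[b Bb /piQP Nbh] <-]; exists (val b); first by exists b.
  by exists (val (b^-1 * h)) => //; rewrite /= mulVKg.
have idI : product_ideal (fun A => conj_equicontinuous (lift A)).
  split.
  - by move=> A B AB; apply: (ideal_sub idE) => _ [h /AB Bh <-]; exists h.
  - move=> A B eA eB; apply: (ideal_sub idE) (ideal_union idE eA eB).
    by move=> _ [h [Ah|Bh] <-]; [left|right]; exists h.
  - move=> A B eA eB; apply: (ideal_sub idE) (ideal_mul idE eA eB).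
    move=> _ [h [a Aa [b Bb abh]] <-].
    exists (val (repr a)); first by exists (repr a); rewrite // /mkset reprK.
    exists (val ((repr a)^-1 * h)); last by rewrite -valM mulVKg.
    exists ((repr a)^-1 * h) => //.
    by rewrite /mkset quotient_piM quotient_piV reprK -abh mulKg.
  - move=> K cK.
    apply: (compact_ideal (I := fun K => conj_equicontinuous (lift K))) cK _ _.
    + by move=> A B AB; apply: (ideal_sub idE) => _ [h /AB Bh <-]; exists h.
    + move=> A B eA eB; apply: (ideal_sub idE) (ideal_union idE eA eB).
      by move=> _ [h [Ah|Bh] <-]; [left|right]; exists h.
    + apply: (ideal_sub idE) (ideal_compact idE (@compact0 G)).
      by move=> _ [h []].
    move=> x _.
    have [V [oV cV _]] := lpH _ (@filterT _ (nbhs (1 : set_type H)) _).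
    have [xV cxV] : nbhs (repr x) ((fun y => repr x * y) @` V) /\
        compact ((fun y => repr x * y) @` V).
      split; last by apply: compact_image => //; exact: mulgl_continuous.
      apply: filterS (coset_nbhs (repr x) oV) => y Vxy.
      by exists ((repr x)^-1 * y) => //; rewrite mulVKg.
    exists (\pi_Q @` ((fun y => repr x * y) @` V)).
      move: xV; rewrite !nbhsE => -[O [oO Ox] OV]; exists (\pi_Q @` O).
        split; first exact: quotient_pi_open.
        by exists (repr x) => //; rewrite reprK.
      exact: image_subset.
    apply: (ideal_sub idE (liftN _ _ (@subset_refl _ _))).
    apply: (ideal_mul idE) => //; apply: (ideal_compact idE).
    by apply: compact_image => //; exact: set_type_val_continuous.
have eT := product_ideal_FC_group lpQ cgQ pcQ idI.
apply: (ideal_sub idE) (eT _) => [x Hx|x].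
  by exists (SigSub (mem_set Hx)).
apply: (ideal_sub idE (liftN _ [set expgz (repr x) n | n in setT] _)).
  move=> _ [n _ <-]; exists (expgz (repr x) n); first by exists n.
  have piX k : \pi_Q (repr x ^+ k) = x ^+ k.
    by elim: k => [|k ih] //; rewrite !expgS quotient_piM reprK ih.
  by case: n => n /=; rewrite ?quotient_piV piX.
apply: (ideal_mul idE) => //; apply: (ideal_sub idE) (cycG (val (repr x))).
move=> _ [_ [n _ <-] <-]; exists n => //.
have valX k : val (repr x ^+ k) = val (repr x) ^+ k.
  by elim: k => [|k ih] //; rewrite !expgS -ih.
by case: n => n //=; rewrite -?valX.
Qed.

(** * Distality and invariant neighbourhoods *)

Lemma conj_equicontinuous_SIN (G : topologicalGroupType) :
  conj_equicontinuous [set: G] -> SIN_group G.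
Proof.
move=> eG U U1; exists [set x | forall g, U (conjl g x)]; split.
- by apply: filterS (eG U U1) => x Ux g; exact: Ux.
- by move=> x /(_ 1); rewrite conj1l.
move=> g; apply/seteqP; split=> [_ [x Ux <-] h|x Ux].
  by have := Ux (h * g); rewrite conjlMl.
exists (conjl g^-1 x); last exact: conjlVK.
by move=> h; rewrite -conjlMl; exact: Ux.
Qed.

Lemma SIN_distal (G : topologicalGroupType) :
  hausdorff_space G -> SIN_group G -> distal_group G.
Proof.
move=> hG sinG x x1 clx; apply: x1; apply: hG => A B Ax B1.
have [V [V1 VB VJ]] := sinG _ B1.
have [y [[g _ <-] Vy]] := clx _ V1.
exists x; split; first exact: nbhs_singleton.
apply: VB; rewrite -(VJ g^-1); exists (g * x * g^-1) => //.
exact: conjlK.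
Qed.

Lemma distal_group_element (G : topologicalGroupType) (g : G) :
  distal_group G -> distal_element g.
Proof.
move=> dG x x1 clx; apply: (dG x x1); apply: closureS clx => _ [n _ <-].
by exists (expgz g n) => //; rewrite expgzN.
Qed.

Lemma distal_cyclic_equicontinuous (G : topologicalGroupType) (g : G) :
  hausdorff_space G -> locally_profinite G -> distal_element g ->
  conj_equicontinuous [set expgz g n | n in [set: int]].
Proof.
move=> hG lpG dg U /lpG[V [oV cV VU]].
have [W [oW WV gW]] := distal_element_normalizes hG dg oV cV.
apply: (filterS (P := subgroup_set W)).
  move=> x Wx _ [n _ <-]; apply/VU/WV.
  have pos k : subgroup_set W (conjl (g ^+ k) x).
    by rewrite conjXl; elim: k => //= k ih; exact: (gW _ ih).1.
  have neg k : subgroup_set W (conjl (g^-1 ^+ k) x).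
    by rewrite conjXl; elim: k => //= k ih; exact: (gW _ ih).2.
  by case: n => n //=; rewrite -expVgn.
by apply: open_nbhs_nbhs; split=> //; exact: subgroup1.
Qed.

Theorem distal_elements_SIN (G : topologicalGroupType) :
  hausdorff_space G -> totally_disconnected [set: G] ->
  generalized_FC_group G -> (forall g : G, distal_element g) -> SIN_group G.
Proof.
move=> hG tdG [lcG [n [N [N0 Nn clN subN FCN]]]] dG.
have lpG := van_dantzig hG tdG lcG.
have cycG g := distal_cyclic_equicontinuous hG lpG (dG g).
suff eN k : (k <= n)%N -> conj_equicontinuous (N (n - k)%N : set G).
  by apply: conj_equicontinuous_SIN; rewrite -N0 -(subnn n); exact: eN.
elim: k => [_|k ih kn].
  rewrite subn0 Nn; apply: (ideal_compact (conj_equicontinuous_ideal G)).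
  exact: compact_set1.
have nk : (n - k.+1 < n)%N by rewrite ltn_subrL (leq_ltn_trans _ kn).
have [cgQ pcQ] := FCN _ nk.
apply: conj_equicontinuous_extension lpG (clN _ (ltnW nk)) cycG cgQ pcQ _.
by rewrite subnSK //; exact/ih/ltnW.
Qed.

Theorem theorem2p9 (G : topologicalGroupType)
  (hausdorffG : hausdorff_space G)
  (totally_disconnectedG : totally_disconnected [set: G])
  (generalized_FCG : generalized_FC_group G) :
  (distal_group G <-> (forall g : G, distal_element g)) /\
  ((forall g : G, distal_element g) <-> SIN_group G).
Proof.
have ds := distal_elements_SIN hausdorffG totally_disconnectedG generalized_FCG.
have sd := @SIN_distal G hausdorffG.
have de dG g := @distal_group_element G g dG.
by split; split=> [dG|dG]; [exact: de|exact/sd/ds|exact: ds|exact/de/sd].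
Qed.
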